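(* Let $Q$ be a non-abelian finite simple group and $g\ge1$. Let $N$ be the number of epimorphisms from the free group $F_g$ onto $Q$ modulo $\mathrm{Aut}(Q)$, and let $\mu=N/|Q|^g$. Then the limiting probability (as the complexity $n\to\infty$) that the group of a random $g$-generator, $g$-relator presentation of complexity $n$ has an epimorphism onto $Q$ equals $$p(Q,g,g)=1-\bigl(1-|Q|^{-g}\bigr)^{|Q|^g\mu}\ (\approx 1-e^{-\mu}).$$ Moreover, as $g\to\infty$, $\mu\to 1/|\mathrm{Aut}(Q)|$, and the limiting distributions (as $n\to\infty$) of the number of epimorphisms onto $Q$ modulo $\mathrm{Aut}(Q)$ converge, as $g\to\infty$, to the Poisson distribution with mean $1/|\mathrm{Aut}(Q)|$.
   Context: A random relator of length $n$ in $F_g=\langle a_1,\dots,a_g\rangle$ is a word $x_1\cdots x_n$ with each $x_j\in\{a_1^{\pm1},\dots,a_g^{\pm1},1\}$, all $(2g+1)^n$ words equally likely; a random balanced presentation of complexity $n$ uses $g$ independent random relators of length $n$. The Poisson distribution with mean $\mu>0$ assigns probability $\mu^ke^{-\mu}/k!$ to $k\in\mathbb{Z}_{\ge0}$. *)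

(* Defs.v *)
From HB Require Import structures.
From mathcomp Require Import all_boot all_order all_algebra all_fingroup gseries.
From mathcomp Require Import all_classical all_reals.
From mathcomp Require Import topology normedtype sequences exp poisson_distribution.
Set Implicit Arguments. Unset Strict Implicit. Unset Printing Implicit Defensive.
Import Order.TTheory GRing.Theory Num.Theory.

(* A letter of a relator over F_g = <a_1,...,a_g>:
   None = the identity letter 1, Some (i, true) = a_i, Some (i, false) = a_i^-1. *)
Notation letter g := (option ('I_g * bool)).

Notation relator g n := {ffun 'I_n -> letter g}.

Notation presentation g n := {ffun 'I_g -> relator g n}.

Section Defs.
Variables (gT : finGroupType).

Definition eval_letter g (x : {ffun 'I_g -> gT}) (l : letter g) : gT :=
  match l with
  | None => 1%g
  | Some (i, b) => if b then x i else ((x i)^-1)%g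
  end.

Definition eval_word g n (x : {ffun 'I_g -> gT}) (w : relator g n) : gT :=
  (\prod_(j < n) eval_letter x (w j))%g.

(* Epimorphisms F_g ->> G, represented by the images of the free generators:
   g-tuples of elements of G generating G. *)
Definition gen_tuples (G : {group gT}) g : {set {ffun 'I_g -> gT}} :=
  [set x : {ffun 'I_g -> gT} |
     [forall i, x i \in G] && (<<[set x i | i : 'I_g]>>%g == G :> {set gT})].

(* Epimorphisms from the group <a_1..a_g | r_1..r_g> onto G: generating
   tuples killing every relator (von Dyck). *)
Definition epi_tuples (G : {group gT}) g n (r : presentation g n)
  : {set {ffun 'I_g -> gT}} :=
  [set x in gen_tuples G g | [forall i, eval_word x (r i) == 1%g]].

Definition aut_orbit (G : {group gT}) g (x : {ffun 'I_g -> gT})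
  : {set {ffun 'I_g -> gT}} :=
  [set [ffun i => (a : {perm gT}) (x i)] | a in Aut G].

Definition num_epi_free_mod_aut (G : {group gT}) g : nat :=
  #|[set aut_orbit G x | x in gen_tuples G g]|.

Definition num_epi_mod_aut (G : {group gT}) g n (r : presentation g n) : nat :=
  #|[set aut_orbit G x | x in epi_tuples G r]|.

End Defs.

Local Open Scope ring_scope.

Definition mu_const (R : realType) (gT : finGroupType) (G : {group gT}) g : R :=
  (num_epi_free_mod_aut G g)%:R / (#|G| ^ g)%N%:R.

Definition pres_prob (R : realType) g n (P : pred (presentation g n)) : R :=
  #|[set r : presentation g n | P r]|%:R / #|{: presentation g n}|%:R.

(* Main.v *)
(* Let x_1, ..., x_N represent the Aut(Q)-orbits of generating g-tuples of Q.
   By Goursat's lemma they jointly generate Q^N, so a random relator, evaluated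
   at all the x_j simultaneously, is a lazy random walk on Q^N and equidistributes.
   Hence in the limit the g relators kill each x_j independently with probability
   |Q|^-g: the number of epimorphisms modulo Aut(Q) is binomial with parameters
   N and |Q|^-g. As Aut(Q) acts freely on generating tuples and almost all tuples
   generate, N / |Q|^g tends to 1/|Aut(Q)|, and the binomial law becomes Poisson. *)
Require Import Defs.
From HB Require Import structures.
From mathcomp Require Import all_boot all_order all_algebra all_fingroup gseries.
From mathcomp Require Import all_classical all_reals.
From mathcomp Require Import topology normedtype sequences exp poisson_distribution.
From mathcomp Require Import commutator ring lra.
Import Order.TTheory GRing.Theory Num.Theory.
Import numFieldNormedType.Exports.
Local Open Scope classical_set_scope.
Local Open Scope ring_scope.

Set Implicit Arguments.
Unset Strict Implicit.
Unset Printing Implicit Defensive.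

Local Open Scope set_scope.

(** * Equidistribution of random words *)

Lemma big_ffun_recr (R : nmodType) (S : finType) n (F : {ffun 'I_n.+1 -> S} -> R) :
  \sum_w F w = \sum_(w : {ffun 'I_n -> S}) \sum_s
    F [ffun i => if unlift ord_max i is Some j then w j else s].
Proof.
pose h (p : {ffun 'I_n -> S} * S) : {ffun 'I_n.+1 -> S} :=
  [ffun i => if unlift ord_max i is Some j then p.1 j else p.2].
pose k (w : {ffun 'I_n.+1 -> S}) := ([ffun j => w (lift ord_max j)], w ord_max).
rewrite pair_big (reindex h) //=; exists k => [[w s] _|w _].
  congr (_, _); last by rewrite ffunE unlift_none.
  by apply/ffunP=> j; rewrite !ffunE liftK.
by apply/ffunP=> i; rewrite ffunE; case: unliftP => [j ->|->]; rewrite ?ffunE.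
Qed.

Section Walk.
Variables (R : realType) (kT : finGroupType) (S : finType) (f : S -> kT).

(** Transition operator on densities: if [h] is the law of a random element, [walk h] is its law
    after right multiplication by a uniform step, whence the inverse. *)
Definition walk (h : kT -> R) (y : kT) : R :=
  #|S|%:R^-1 * \sum_s h (y * (f s)^-1)%g.

Lemma iter_walk n (h : kT -> R) y :
  iter n walk h y =
  (#|S| ^ n)%:R^-1 * \sum_(w : {ffun 'I_n -> S}) h (y * (\prod_(j < n) f (w j))^-1)%g.
Proof.
elim: n y => [|n IHn] y.
  rewrite expn0 invr1 mul1r; pose w0 : {ffun 'I_0 -> S} := ffun0 (card_ord 0).
  rewrite (big_pred1 w0) ?big_ord0 ?invg1 ?mulg1 //.
  by move=> w; apply/esym/eqP/ffunP=> -[].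
rewrite iterS /walk; under eq_bigr do rewrite IHn.
rewrite -big_distrr /= mulrA -invfM -natrM -expnS; congr (_ * _).
rewrite big_ffun_recr exchange_big; apply: eq_bigr => s _; apply: eq_bigr => w _.
rewrite big_ord_recr /= ffunE unlift_none invMg mulgA; congr (h (_ * _^-1)%g).
apply: eq_bigr => j _; rewrite ffunE; congr f.
suff -> : widen_ord (leqnSn n) j = lift ord_max j by rewrite liftK.
by apply: ord_inj; rewrite lift_max.
Qed.

Variables (G : {group kT}) (s0 : S).
Hypothesis fs0 : f s0 = 1%g.
Hypothesis fG : <<[set f s | s : S]>>%g = G.

Lemma step_in s : f s \in G.
Proof. by rewrite -fG mem_gen // imset_f. Qed.

Lemma word_in n (w : 'I_n -> S) : (\prod_(j < n) f (w j))%g \in G.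
Proof. by apply: group_prod => j _; apply: step_in. Qed.

Lemma card_step_gt0 : (0 < #|S|)%N.
Proof. by apply/card_gt0P; exists s0. Qed.

Lemma iter_walk_bound n (h : kT -> R) a b :
  {in G, forall y, a <= h y <= b} -> {in G, forall y, a <= iter n walk h y <= b}.
Proof.
move=> hab y yG; rewrite iter_walk.
have q0 : 0 < (#|S| ^ n)%:R :> R by rewrite ltr0n expn_gt0 card_step_gt0.
rewrite mulrC ler_pdivlMr // ler_pdivrMr //.
have sumc c : c * (#|S| ^ n)%:R = \sum_(w : {ffun 'I_n -> S}) c.
  by rewrite sumr_const card_ffun card_ord mulr_natr.
by rewrite !sumc; apply/andP; split; apply: ler_sum => w _;
  have /andP[] := hab _ (groupM yG (groupVr (word_in w))).
Qed.

(* Doeblin's argument: each point receives mass at least 1/|S|^m from the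
   identity, so m steps shrink the oscillation by the factor 1 - 1/|S|^m. *)
Lemma iter_walk_shrink m (h : kT -> R) a b :
  {in G, forall y, exists w : {ffun 'I_m -> S}, (\prod_(j < m) f (w j))%g = y} ->
  {in G, forall y, a <= h y <= b} ->
  exists a' b', b' - a' = (1 - (#|S| ^ m)%:R^-1) * (b - a) /\
    {in G, forall y, a' <= iter m walk h y <= b'}.
Proof.
set d : R := _^-1 => Hm hab.
(* A word with product [y] contributes exactly [d * h 1]; the other words carry weight [1 - d] and
   values in [[a, b]]. *)
exists (a + d * (h 1%g - a)), (b - d * (b - h 1%g)); split; first by ring.
move=> y yG; have [w0 w0y] := Hm y yG; rewrite iter_walk -/d (bigD1 w0) //=.
rewrite w0y mulgV.
have q0 : 0 < (#|S| ^ m)%:R :> R by rewrite ltr0n expn_gt0 card_step_gt0.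
have dq : d * (#|S| ^ m)%:R = 1 by rewrite mulVf // gt_eqF.
have d0 : 0 <= d by rewrite invr_ge0 ltW.
have sumc c : d * \sum_(w : {ffun 'I_m -> S} | w != w0) c = c - d * c.
  have : \sum_(w : {ffun 'I_m -> S}) c = c * (#|S| ^ m)%:R.
    by rewrite sumr_const card_ffun card_ord mulr_natr.
  rewrite (bigD1 w0) //= => /(congr1 ( *%R d)).
  by rewrite mulrCA dq mulr1 mulrDr => e; rewrite -[X in _ = X - _]e addrAC subrr add0r.
rewrite mulrDr.
have [l u] : (a - d * a <= d * \sum_(w : {ffun 'I_m -> S} | w != w0)
                h (y * (\prod_(j < m) f (w j))^-1)%g) /\
             (d * \sum_(w : {ffun 'I_m -> S} | w != w0)
                h (y * (\prod_(j < m) f (w j))^-1)%g <= b - d * b).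
  by rewrite -!sumc; split; apply: ler_wpM2l => //; apply: ler_sum => w _;
    have /andP[] := hab _ (groupM yG (groupVr (word_in w))).
by apply/andP; split; lra.
Qed.

(** The identity letter [s0] makes the walk lazy: words can be padded, so the maximum of the lengths
    needed for the finitely many elements serves them all. *)
Lemma common_word_length : exists2 m, (0 < m)%N &
  {in G, forall y, exists w : {ffun 'I_m -> S}, (\prod_(j < m) f (w j))%g = y}.
Proof.
pose reach n y := exists w : {ffun 'I_n -> S}, (\prod_(j < n) f (w j))%g = y.
have reachS n y : reach n y -> reach n.+1 y.
  case=> w <-; exists [ffun i => if unlift ord_max i is Some j then w j else s0].
  rewrite big_ord_recr /= ffunE unlift_none fs0 mulg1; apply: eq_bigr => j _.
  rewrite ffunE; have -> : widen_ord (leqnSn n) j = lift ord_max j.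
    by apply: ord_inj; rewrite lift_max.
  by rewrite liftK.
have reachD n k y : reach n y -> reach (k + n)%N y.
  by move=> r; elim: k => // k; apply: reachS.
have ex y : exists n, y \in G -> reach n y.
  have [yG|_] := boolP (y \in G); last by exists 0%N.
  move: yG; rewrite -fG => /gen_prodgP[n [c cS ->]]; exists n => _.
  have /fin_all_exists[w wP] i : exists s, c i = f s.
    by have /imsetP[s _ ->] := cS i; exists s.
  by exists [ffun i => w i]; apply: eq_bigr => i _; rewrite ffunE wP.
have [len lenP] := fin_all_exists ex.
(* The successor keeps [m] positive, as the later division of [n] into blocks of length [m]
   requires. *)
exists (\max_y len y).+1 => // y yG; apply: reachS.
by rewrite -(subnK (leq_bigmax y)); apply/reachD/lenP.
Qed.

Lemma card_words_at n y :
  (#|S| ^ n)%:R^-1 * #|[set w : {ffun 'I_n -> S} | (\prod_(j < n) f (w j))%g == y]|%:R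
  = iter n walk (fun z => (z == 1%g)%:R) y.
Proof.
rewrite iter_walk; congr (_ * _); rewrite -sum1_card natr_sum big_mkcond /=.
apply: eq_bigr => w _; rewrite inE -eq_mulgV1 eq_sym.
by case: eqP.
Qed.

(** The oscillation over [G] of the law after [n] steps decays like [c ^+ (n %/ m)], and the mean
    value [1/|G|] always lies between its bounds. Outside [G] no word ever arrives. *)
Lemma cvg_walk y :
  (fun n => #|[set w : {ffun 'I_n -> S} | (\prod_(j < n) f (w j))%g == y]|%:R
    / (#|S| ^ n)%:R) @ \oo --> ((y \in G)%:R / #|G|%:R : R).
Proof.
have [yG|yG] := boolP (y \in G); last first.
  rewrite mul0r; apply: cvg_near_cst; near=> n.
  rewrite (_ : [set w | _] = finset.set0) ?cards0 ?mul0r //.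
  apply/setP => w; rewrite !inE; apply: contraNF yG => /eqP <-.
  exact: word_in.
have [m m0 Hm] := common_word_length.
pose h n := iter n walk (fun z => (z == 1%g)%:R).
pose c : R := 1 - (#|S| ^ m)%:R^-1.
have osc q : exists a b, b - a = c ^+ q /\ {in G, forall y, a <= h (q * m)%N y <= b}.
  elim: q => [|q [a [b [ab hq]]]].
    exists 0, 1; rewrite subr0; split=> // z _.
    by rewrite /h /=; case: eqP; rewrite ?lexx ler01.
  have [a' [b' [ab' hq']]] := iter_walk_shrink Hm hq.
  exists a', b'; rewrite ab' ab exprS; split=> // z zG.
  by rewrite mulSn /h iterD; apply: hq'.
have sum1 n : \sum_(z in G) h n z = 1.
  under eq_bigr do rewrite /h -card_words_at.
  rewrite -big_distrr /= -natr_sum.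
  rewrite (_ : (\sum_(z in G) _)%N = #|S| ^ n)%N.
    by rewrite mulVf // pnatr_eq0 -lt0n expn_gt0 card_step_gt0.
  have := card_ffun 'I_n S; rewrite card_ord -sum1_card => <-.
  rewrite (partition_big (fun w : {ffun 'I_n -> S} => \prod_(j < n) f (w j))%g
    (mem G)) /=; last by move=> w _; apply: word_in.
  apply: eq_bigr => z _; rewrite -sum1_card; apply: eq_bigl => w.
  by rewrite inE.
have G0 : 0 < #|G|%:R :> R by rewrite ltr0n cardG_gt0.
have bnd n : `|h n y - #|G|%:R^-1| <= c ^+ (n %/ m).
  have [a [b [<- hq]]] := osc (n %/ m)%N.
  have hn : {in G, forall z, a <= h n z <= b}.
    (* The [n %% m] steps left after the full blocks do not widen the interval. *)
    rewrite (divn_eq n m) addnC /h iterD; exact: iter_walk_bound.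
  have /andP[ya yb] := hn y yG.
  have sumc d : \sum_(z in G) d = d * #|G|%:R by rewrite sumr_const mulr_natr.
  have la : a <= #|G|%:R^-1.
    rewrite -[leRHS]mul1r ler_pdivlMr // -sumc -[leRHS](sum1 n).
    by apply: ler_sum => z zG; have /andP[] := hn z zG.
  have lb : #|G|%:R^-1 <= b.
    rewrite -[leLHS]mul1r ler_pdivrMr // -sumc -[leLHS](sum1 n).
    by apply: ler_sum => z zG; have /andP[] := hn z zG.
  by rewrite ler_norml; apply/andP; split; lra.
have q1 : 1 <= (#|S| ^ m)%:R :> R by rewrite ler1n expn_gt0 card_step_gt0.
have c1 : `|c| < 1.
  rewrite /c ger0_norm ?subr_ge0 ?invf_le1 ?(lt_le_trans ltr01) //.
  by rewrite ltrBlDr ltrDl invr_gt0 (lt_le_trans ltr01).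
have cdiv : (n %/ m)%N @[n --> \oo] --> \oo.
  move=> A [k _ kA]; exists (k * m)%N => // n /= kn; apply: kA => /=.
  by rewrite leq_divRL.
have /cvgr0_norm_lt c0 : c ^+ (n %/ m) @[n --> \oo] --> 0.
  exact: (cvg_comp _ _ cdiv (cvg_expr c1)).
rewrite mul1r; apply/cvgrPdist_lt => e e0; near=> n.
rewrite mulrC card_words_at -/(h n y) distrC (le_lt_trans (bnd n)) //.
by rewrite (le_lt_trans (ler_norm _)) //; near: n; apply: c0.
Unshelve. all: by end_near. Qed.

End Walk.

(** * Subdirect powers of a non-abelian simple group *)

Lemma simple_perfect (gT : finGroupType) (Q : {group gT}) :
  simple Q -> ~~ abelian Q -> [~: Q, Q]%g = Q.
Proof.
move=> /simpleP[_ simQ] nabQ.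
have [/commG1P|//] := simQ [group of [~: Q, Q]%g] (der_normal 1 Q).
by rewrite -/(abelian Q) (negPf nabQ).
Qed.

Section Goursat.
Variables (gT : finGroupType) (J : finType) (Q : {group gT}).
Variable H : {group {dffun forall j : J, gT}}.
Local Notation proj j := (@dffun_morphism J (fun=> gT) j).

Hypothesis simQ : simple Q.
Hypothesis nabQ : ~~ abelian Q.
Hypothesis projQ : forall j, (proj j @* H)%g = Q.
Hypothesis indep : forall j k a, j != k -> a \in Aut Q ->
  exists2 h, h \in H & h j != (a : {perm gT}) (h k).

Lemma proj_in h j : h \in H -> h j \in Q.
Proof. by move=> hH; rewrite -(projQ j); apply: (mem_morphim (proj j)); rewrite ?inE. Qed.

(* If the kernel of the k-th projection were contained in that of the j-th
   one, H would project to the graph of an automorphism of Q in Q_k x Q_j. *)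
Lemma proj_ker_full j k : j != k -> (proj j @* 'ker_H (proj k))%g = Q.
Proof.
move=> jk; have /simpleP[_ /(_ [group of (proj j @* 'ker_H (proj k))%g])] := simQ.
case=> [|D1|//].
  by rewrite -[X in (_ <| X)%g](projQ j); apply: morphim_normal; apply: normalGI (finset.subsetT H) (ker_normal _).
exfalso.
pose f := restrm_morphism (finset.subsetT H) (proj j).
pose q := restrm_morphism (finset.subsetT H) (proj k).
have sKK : ('ker q \subset 'ker f)%g.
  rewrite /f /q !ker_restrm; apply/fintype.subsetP=> h hK; rewrite inE.
  have /finset.setIP[hH hk] := hK; rewrite hH /=; apply/kerP; first by rewrite inE.
  have : proj j h \in (proj j @* 'ker_H (proj k))%g by apply: mem_morphim; rewrite ?finset.in_setT.
  by rewrite (D1 : (proj j @* 'ker_H (proj k))%g = 1%g) => /set1gP.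
have qH : (q @* H)%g = Q by rewrite morphim_restrm finset.setIid projQ.
have fH : (f @* H)%g = Q by rewrite morphim_restrm finset.setIid projQ.
(* [F] sends the [k]-th coordinate of an element of [H] to its [j]-th one. It maps [Q] onto [Q], so
   it is injective by cardinality. *)
pose F := factm_morphism sKK (subxx H).
have FH : (F @* (q @* H))%g = (q @* H)%g by rewrite morphim_factm fH qH.
have injF : ('injm F)%g by rewrite -card_im_injm FH.
have aA : aut injF FH \in Aut Q by rewrite -qH Aut_aut.
have [h hH /negP[]] := indep jk aA.
have -> : h k = q h by [].
by rewrite autE ?(mem_morphim q) //; apply/eqP/esym; apply: factmE.
Qed.

(* By commutators, the elements of H trivial on s and those trivial at k
   combine to elements of H trivial on k :: s. *)
Lemma proj_trivial_full j (s : seq J) x : j \notin s -> x \in Q ->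
  exists2 h, h \in H & h j = x /\ {in s, forall k, h k = 1%g}.
Proof.
pose K (s : seq J) := setXn_group (fun k => if k \in s then 1%G else [set: gT]%G).
have KP (s' : seq J) (h : {dffun forall j : J, gT}) : reflect {in s', forall k, h k = 1%g} (h \in K s').
  apply: (iffP setXnP) => [hK k ks|hK k].
    by have := hK k; rewrite ks => /set1gP.
  by have := hK k; case: ifP => [_ /(_ isT) ->|]; rewrite ?inE.
suff full : j \notin s -> Q \subset (proj j @* (H :&: K s))%g.
  move=> js xQ; have /morphimP[h _ /finset.setIP[hH /KP hK] ->] := fintype.subsetP (full js) x xQ.
  by exists h.
elim: s {x} => [_|k s IHs].
  rewrite -(projQ j) morphimS //; apply/fintype.subsetP=> h hH.
  by rewrite inE hH; apply/KP.
rewrite inE negb_or => /andP[jk js].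
(* As [Q] is perfect, it suffices to reach each commutator of [u] and [v]: lift [u] to an element
   trivial on [s] and [v] to one trivial at [k]. *)
rewrite -{1}(simple_perfect simQ nabQ) gen_subG.
apply/fintype.subsetP => _ /imset2P[u v uQ vQ ->].
have /morphimP[h _ /finset.setIP[hH /KP hK] ->] := fintype.subsetP (IHs js) u uQ.
move: vQ; rewrite -(proj_ker_full jk) => /morphimP[h' _ /finset.setIP[hH' hK'] ->].
have h'k : h' k = 1%g by apply: (mker hK').
rewrite -morphR ?inE //; apply: mem_morphim; rewrite inE // groupR //=.
apply/KP=> l; rewrite inE /commg /conjg !ffunE => /predU1P[->|/hK ->].
  by rewrite h'k !(invg1, mulg1, mul1g, mulVg).
by rewrite !(invg1, mulg1, mul1g, mulVg).
Qed.

(** The power of [Q] is generated by its coordinate factors, and each factor lies in [H]: apply the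
    previous lemma with [s] all the other coordinates. *)
Lemma subdirect_full : H = setXn_group (fun _ : J => Q).
Proof.
apply/val_inj/eqP; rewrite /= finset.eqEsubset; apply/andP; split.
  by apply/fintype.subsetP=> h hH; apply/setXnP=> j; apply: proj_in.
rewrite -(setXn_prod (fun _ : J => Q)) prod_subG // => j _.
apply/fintype.subsetP=> _ /set1gXnP[x xQ ->].
have [|h hH [hj hk]] := @proj_trivial_full j (enum (predC1 j)) x _ xQ.
  by rewrite mem_enum !inE eqxx.
suff -> : @dfung1 J (fun=> gT) j x = h by [].
apply/ffunP=> k; have [<-|jk] := eqVneq j k; first by rewrite dfung1_id hj.
by rewrite dfung1_dflt // hk // mem_enum !inE eq_sym.
Qed.
End Goursat.

(** * Independent words *)

(** Choose the [k] positions with value [b]; every other position takes one of the [#|B|.-1]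
    remaining values. This is the count behind the binomial law. *)
Lemma card_ffun_hits (J T : finType) (B : {set T}) b k : b \in B ->
  #|[set z : {ffun J -> T} | [forall j, z j \in B] && (#|[set j | z j == b]| == k)]|
  = ('C(#|J|, k) * #|B|.-1 ^ (#|J| - k))%N.
Proof.
move=> bB; rewrite -card_draws -sum1_card -sum_nat_const.
rewrite (partition_big (fun z : {ffun J -> T} => [set j | z j == b])
  (fun A : {set J} => A \in [set A : {set J} | #|A| == k])) /=; last first.
  by move=> z; rewrite !inE => /andP[].
apply: eq_bigr => A.
rewrite inE => /eqP Ak; rewrite sum1_card.
pose F j := if j \in A then [set b] else B :\ b.
rewrite (_ : #|_| = #|setXn F|).
  rewrite cardsXn (bigID (mem A)) /=.
  under eq_bigr => j jA do rewrite /F jA cards1.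
  rewrite big1_eq mul1n.
  under eq_bigr => j jA do rewrite /F (negPf jA).
  by rewrite prod_nat_const (cardsD1 b B) bB -Ak -(cardC (mem A)) addKn.
apply: eq_card => z; rewrite in_setXn unfold_in inE; apply/andP/forallP => [[/andP[/forallP zB _] /eqP zA] j|zF].
  by rewrite /F -zA inE; case: eqP => [->|/eqP zb]; rewrite !inE ?eqxx ?zb ?zB.
have zA : [set j | z j == b] = A.
  apply/setP=> j; rewrite inE; have := zF j; rewrite /F.
  by case: ifP => _; rewrite !inE => // /andP[/negPf ->].
rewrite zA Ak !eqxx andbT; split=> //; apply/forallP=> j; have := zF j; rewrite /F.
by case: ifP => _; [rewrite inE => /eqP ->|rewrite !inE => /andP[]].
Qed.

Section IndependentWords.
Variables (R : realType) (kT : finGroupType) (S : finType) (f : S -> kT).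
Variables (G : {group kT}) (s0 : S).
Hypothesis fs0 : f s0 = 1%g.
Hypothesis fG : <<[set f s | s : S]>>%g = G.

(** The words indexed by [I] are independent, so the probability is a finite sum over [A] of
    products of one-word probabilities, and the one-word limits pass through. *)
Lemma cvg_words (I : finType) (A : {set {ffun I -> kT}}) :
  (fun n => #|[set r : {ffun I -> {ffun 'I_n -> S}} |
      [ffun i => \prod_(j < n) f (r i j)]%g \in A]|%:R
    / #|{: {ffun I -> {ffun 'I_n -> S}}}|%:R) @ \oo -->
  (#|[set y in A | [forall i, y i \in G]]|%:R / (#|G| ^ #|I|)%:R : R).
Proof.
pose W n (y : kT) := [set w : {ffun 'I_n -> S} | (\prod_(j < n) f (w j))%g == y].
have -> : #|[set y in A | [forall i, y i \in G]]|%:R / (#|G| ^ #|I|)%:R =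
    \sum_(y in A) \prod_i ((y i \in G)%:R / #|G|%:R) :> R.
  rewrite -sum1dep_card natr_sum big_mkcondr /= big_distrl /=.
  apply: eq_bigr => y _; rewrite big_split /= -natr_prod prodr_const natrX exprVn.
  congr (_ / _); case: forallP => [yG|/forallP/forallPn[i yi]].
    by rewrite big1 // => i _; rewrite yG.
  by rewrite (bigD1 i) //= (negPf yi) mul0n.
rewrite (_ : (fun n => _) = (fun n => \sum_(y in A) \prod_i
    (#|W n (y i)|%:R / (#|S| ^ n)%:R))); last first.
  apply/funext => n; rewrite card_ffun card_ffun card_ord.
  rewrite (_ : #|_| = \sum_(y in A) \prod_i #|W n (y i)|)%N.
    rewrite natr_sum big_distrl /=; apply: eq_bigr => y _.
    by rewrite big_split /= -natr_prod prodr_const natrX exprVn.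
  rewrite -sum1_card (partition_big (fun r : {ffun I -> {ffun 'I_n -> S}} =>
    [ffun i => \prod_(j < n) f (r i j)]%g) (mem A)) /=; last first.
    by move=> r; rewrite inE.
  apply: eq_bigr => y yA; rewrite -(cardsXn (fun i => W n (y i))) sum1_card.
  apply: eq_card => r; rewrite in_setXn unfold_in inE; apply/andP/forallP => [[_ /eqP <-] i|rW].
    by rewrite !inE ffunE.
  have ry : [ffun i => \prod_(j < n) f (r i j)]%g = y.
    by apply/ffunP=> i; have := rW i; rewrite inE ffunE => /eqP.
  by rewrite ry.
apply: cvg_big => [|y _]; first exact: add_continuous.
apply: cvg_big => [|i _]; first exact: mul_continuous.
exact: cvg_walk fs0 fG _.
Qed.
End IndependentWords.

(** * Orbits of generating tuples *)

Section Orbits.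
Variables (gT : finGroupType) (Q : {group gT}) (g : nat).
Implicit Types (x y : {ffun 'I_g -> gT}) (a b : {perm gT}).

Lemma gen_tuple_in x i : x \in gen_tuples Q g -> x i \in Q.
Proof. by rewrite inE => /andP[/forallP]. Qed.

Lemma gen_tuple_gen x : x \in gen_tuples Q g -> <<[set x i | i : 'I_g]>>%g = Q.
Proof. by rewrite inE => /andP[_ /eqP]. Qed.

Lemma aut_orbit_refl x : x \in aut_orbit Q x.
Proof.
by apply/imsetP; exists 1%g; [exact: group1|apply/ffunP=> i; rewrite ffunE perm1].
Qed.

Lemma aut_orbit_act a x : a \in Aut Q ->
  aut_orbit Q [ffun i => a (x i)] = aut_orbit Q x.
Proof.
move=> aA; apply/setP=> y; apply/imsetP/imsetP => -[b bA ->].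
  exists (a * b)%g; first by rewrite groupM.
  by apply/ffunP=> i; rewrite !ffunE permM.
exists (a^-1 * b)%g; first by rewrite groupM ?groupV.
by apply/ffunP=> i; rewrite !ffunE permM permK.
Qed.

Lemma aut_orbit_eqP x y :
  reflect (exists2 a, a \in Aut Q & y = [ffun i => a (x i)])
    (aut_orbit Q x == aut_orbit Q y).
Proof.
apply: (iffP eqP) => [xy|[a aA ->]]; last by rewrite aut_orbit_act.
by have := aut_orbit_refl y; rewrite -xy => /imsetP[a]; exists a.
Qed.

Lemma aut_prod a (I : Type) (r : seq I) (F : I -> gT) :
  a \in Aut Q -> (forall i, F i \in Q) ->
  a (\prod_(i <- r) F i)%g = (\prod_(i <- r) a (F i))%g.
Proof.
by move=> aA FQ; have := morph_prod (autm_morphism aA) r (fun i _ => FQ i); apply.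
Qed.

Lemma gen_tuples_act a x : a \in Aut Q ->
  x \in gen_tuples Q g -> [ffun i => a (x i)] \in gen_tuples Q g.
Proof.
move=> aA xQ; rewrite inE; apply/andP; split.
  by apply/forallP=> i; rewrite ffunE Aut_closed ?gen_tuple_in.
rewrite (_ : [set _ | i : 'I_g] = (autm_morphism aA @* [set x i | i : 'I_g])%g).
  rewrite -morphim_gen ?(gen_tuple_gen xQ) ?im_autm //.
  by apply/fintype.subsetP => _ /imsetP[i _ ->]; apply: gen_tuple_in.
rewrite morphimEsub /=; last first.
  by apply/fintype.subsetP => _ /imsetP[i _ ->]; apply: gen_tuple_in.
by rewrite -imset_comp; apply: eq_imset => i; rewrite ffunE.
Qed.

(** Freeness of the action: an automorphism is determined by its values on generators. *)
Lemma aut_act_inj x : x \in gen_tuples Q g ->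
  {in Aut Q &, injective (fun a : {perm gT} => [ffun i => a (x i)])}.
Proof.
move=> xQ a b aA bA /ffunP ab; apply: (eq_Aut aA bA) => z.
rewrite -{1}(gen_tuple_gen xQ) => /gen_prodgP[n [c cx ->]].
have cE i : exists k, c i = x k by have /imsetP[k _ ->] := cx i; exists k.
have cQ i : c i \in Q by have [k ->] := cE i; apply: gen_tuple_in.
rewrite !aut_prod //; apply: eq_bigr => i _.
by have [k ->] := cE i; have := ab k; rewrite !ffunE.
Qed.

(** By freeness every orbit of generating tuples has exactly [#|Aut Q|] elements. *)
Lemma card_gen_tuples :
  #|gen_tuples Q g| = (num_epi_free_mod_aut Q g * #|Aut Q|)%N.
Proof.
rewrite -sum1_card (partition_big (@aut_orbit gT Q g)
  (mem [set aut_orbit Q x | x in gen_tuples Q g])) /=; last first.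
  by move=> x xQ; apply: imset_f.
rewrite -sum_nat_const; apply: eq_bigr => _ /imsetP[x xQ ->].
rewrite -(card_in_imset (aut_act_inj xQ)) sum1_card; apply: eq_card => y.
rewrite unfold_in; apply/andP/imsetP => [[yQ]|[a aA ->]].
  by rewrite eq_sym => /aut_orbit_eqP.
by rewrite gen_tuples_act // aut_orbit_act.
Qed.

Lemma eval_word_act a n x (w : relator g n) : a \in Aut Q ->
  (forall i, x i \in Q) -> eval_word [ffun i => a (x i)] w = a (eval_word x w).
Proof.
move=> aA xQ; have aM := autmE aA; rewrite /eval_word aut_prod //; last first.
  by move=> j; case: (w j) => [[i []]|]; rewrite /= ?groupV.
apply: eq_bigr => j _; case: (w j) => [[i []]|] /=; rewrite ?ffunE //.
  by rewrite -aM morphV //.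
by rewrite -aM morph1.
Qed.

Lemma epi_tuplesP n x (r : presentation g n) :
  reflect (x \in gen_tuples Q g /\ forall i, eval_word x (r i) = 1%g)
    (x \in epi_tuples Q r).
Proof.
apply: (iffP setIdP) => -[xQ].
  by move=> /forallP xr; split=> // i; apply/eqP.
by move=> xr; split=> //; apply/forallP => i; apply/eqP.
Qed.

Lemma orbit_representatives :
  exists rep : 'I_(num_epi_free_mod_aut Q g) -> {ffun 'I_g -> gT},
  [/\ forall j, rep j \in gen_tuples Q g,
      injective (fun j => aut_orbit Q (rep j)) &
      forall x, x \in gen_tuples Q g -> exists j, aut_orbit Q x = aut_orbit Q (rep j)].
Proof.
pose O := [set aut_orbit Q x | x in gen_tuples Q g].
have /fin_all_exists2[rep repQ repE] (j : 'I_#|O|) :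
    exists2 x, x \in gen_tuples Q g & enum_val j = aut_orbit Q x.
  by have /imsetP[x xQ e] := enum_valP j; exists x.
exists rep; split=> // [j k|x xQ]; first by rewrite -!repE; apply: enum_val_inj.
have xO : aut_orbit Q x \in O by apply: imset_f.
by exists (enum_rank_in xO (aut_orbit Q x)); rewrite -repE enum_rankK_in.
Qed.

Variable rep : 'I_(num_epi_free_mod_aut Q g) -> {ffun 'I_g -> gT}.
Hypothesis repQ : forall j, rep j \in gen_tuples Q g.
Hypothesis rep_inj : injective (fun j => aut_orbit Q (rep j)).
Hypothesis rep_surj : forall x, x \in gen_tuples Q g ->
  exists j, aut_orbit Q x = aut_orbit Q (rep j).

(** Evaluation commutes with automorphisms, so whether the relators die depends only on the orbit
    and can be tested on its representative. *)
Lemma num_epi_mod_autE n (r : presentation g n) :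
  num_epi_mod_aut Q r = #|[set j | [forall i, eval_word (rep j) (r i) == 1%g]]|.
Proof.
rewrite -(card_imset _ rep_inj); apply: eq_card => o.
apply/imsetP/imsetP => [[x /epi_tuplesP[xQ xr] ->]|[j jr ->]]; last first.
  exists (rep j) => //; apply/epi_tuplesP; split=> // i.
  by move: jr; rewrite inE => /forallP/(_ i)/eqP.
have [j xj] := rep_surj xQ; exists j => //; rewrite inE; apply/forallP=> i.
have /eqP/aut_orbit_eqP[a aA ->] := xj.
rewrite eval_word_act // => [|k]; last exact: gen_tuple_in.
by rewrite xr -(autmE aA) morph1.
Qed.

(** The step of the walk on the power of [Q]: one letter evaluated at all representatives
    simultaneously. *)
Definition rep_letter (l : letter g) : {dffun forall j : 'I_(num_epi_free_mod_aut Q g), gT} :=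
  [ffun j => eval_letter (rep j) l].

Lemma prod_rep_letter n (w : relator g n) j :
  (\prod_(i < n) rep_letter (w i))%g j = eval_word (rep j) w.
Proof. by rewrite prodg_ffun; apply: eq_bigr => i _; rewrite ffunE. Qed.

(** Goursat applies: each projection is onto because each representative generates [Q], and no
    automorphism links two coordinates because distinct representatives lie in distinct orbits. *)
Lemma rep_letter_gen : simple Q -> ~~ abelian Q ->
  <<[set rep_letter l | l : letter g]>>%g =
    setXn_group (fun _ : 'I_(num_epi_free_mod_aut Q g) => Q).
Proof.
move=> simQ nabQ; set A := [set _ | _ in _].
apply: (congr1 val (subdirect_full (H := [group of <<A>>%g]) simQ nabQ _ _)) => [j|j k a jk aA].
  rewrite morphim_gen ?finset.subsetT //= -[RHS](gen_tuple_gen (repQ j)).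
  apply/eqP; rewrite finset.eqEsubset !gen_subG; apply/andP; split.
    apply/fintype.subsetP => _ /morphimP[_ _ /imsetP[l _ ->] ->] /=; rewrite ffunE.
    by case: l => [[i []]|] /=; rewrite ?groupV ?group1 // mem_gen // imset_f.
  apply/fintype.subsetP => _ /imsetP[i _ ->]; rewrite mem_gen //.
  have -> : rep j i = rep_letter (Some (i, true)) j by rewrite ffunE.
  by apply: mem_morphim; rewrite ?finset.in_setT ?imset_f.
have : [exists i, rep j i != a (rep k i)].
  apply: contraNT jk => /existsPn e; apply/eqP/rep_inj/esym/eqP/aut_orbit_eqP.
  by exists a => //; apply/ffunP => i; rewrite ffunE; apply/eqP/negPn/e.
case/existsP=> i ne; exists (rep_letter (Some (i, true))).
  by rewrite mem_gen // imset_f.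
by rewrite !ffunE.
Qed.

End Orbits.

(** * The binomial limit law for a fixed number of generators *)

Definition binom_pmf (R : realType) (N : nat) (p : R) (k : nat) : R :=
  'C(N, k)%:R * p ^+ k * (1 - p) ^+ (N - k).

(** The [g] relator values become uniform on the [g]-th power of [Q^N]. Read by orbits, these are
    [N] independent uniform elements of [Q^g], and an orbit survives when its element is trivial. *)
Lemma cvg_num_epi (R : realType) (gT : finGroupType) (Q : {group gT}) (g k : nat) :
  simple Q -> ~~ abelian Q ->
  (fun n : nat =>
     pres_prob R (fun r : presentation g n => num_epi_mod_aut Q r == k)) @ \oo -->
  binom_pmf (num_epi_free_mod_aut Q g) ((#|Q| ^ g)%N%:R^-1 : R) k.
Proof.
move=> simQ nabQ; have [rep [repQ rep_inj rep_surj]] := orbit_representatives Q g.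
set N := num_epi_free_mod_aut Q g.
pose f := rep_letter rep; pose G := setXn_group (fun _ : 'I_N => Q).
pose A := [set y : {ffun 'I_g -> {dffun forall j : 'I_N, gT}} |
  #|[set j | [forall i, y i j == 1%g]]| == k].
have f1 : f None = 1%g by apply/ffunP=> j; rewrite !ffunE.
have fG : <<[set f l | l : letter g]>>%g = G by apply: rep_letter_gen.
have := @cvg_words R _ _ f G None f1 fG 'I_g A.
rewrite (_ : (fun n => _) = (fun n => pres_prob R
    (fun r : presentation g n => num_epi_mod_aut Q r == k))); last first.
  apply/funext=> n; rewrite /pres_prob; congr (_%:R / _); apply: eq_card => r.
  rewrite !inE (num_epi_mod_autE repQ rep_inj rep_surj).
  congr (_ == _); apply: eq_card => j; rewrite !inE.
  by apply: eq_forallb => i; rewrite ffunE prod_rep_letter.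
rewrite card_ord cardsXn prod_nat_const card_ord.
pose B := setXn (fun _ : 'I_g => Q).
rewrite (_ : #|_| = 'C(N, k) * #|B|.-1 ^ (N - k))%N; last first.
  have B1 : [ffun=> 1%g] \in B by apply/setXnP=> i; rewrite ffunE.
  have := card_ffun_hits 'I_N k B1; rewrite card_ord => <-.
  (* Transposition, from rows indexed by relators to columns indexed by orbits, puts the count in
     the form of [card_ffun_hits]. *)
  pose t (y : {ffun 'I_g -> {dffun forall j : 'I_N, gT}}) :
    {ffun 'I_N -> {ffun 'I_g -> gT}} := [ffun j => [ffun i => y i j]].
  have t_inj : injective t.
    move=> y z yz; apply/ffunP=> i; apply/ffunP=> j.
    by move/ffunP/(_ j): yz; rewrite !ffunE => /ffunP/(_ i); rewrite !ffunE.
  have tB y : [forall j, t y j \in B] = [forall i, y i \in G].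
    apply/forallP/forallP => yB i.
      by apply/setXnP=> j; have /setXnP/(_ i) := yB j; rewrite !ffunE.
    by apply/setXnP=> j; rewrite !ffunE; have /setXnP/(_ i) := yB j.
  have tk y : [set j | t y j == [ffun=> 1%g]] = [set j | [forall i, y i j == 1%g]].
    apply/setP=> j; rewrite !inE; apply/eqP/forallP => [/ffunP e i|e].
      by have := e i; rewrite !ffunE => ->.
    by apply/ffunP=> i; rewrite !ffunE; apply/eqP/e.
  rewrite -(card_imset _ t_inj); apply: eq_card => z.
  apply/imsetP/idP => [[y + ->]|]; rewrite !inE.
    by rewrite tB tk andbC.
  move=> zk; pose y : {ffun 'I_g -> {dffun forall j : 'I_N, gT}} := [ffun i => [ffun j => z j i]].
  have zy : z = t y by apply/ffunP=> j; apply/ffunP=> i; rewrite !ffunE.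
  by exists y => //; move: zk; rewrite zy tB tk !inE andbC.
rewrite cardsXn prod_nat_const card_ord -expnM [(N * g)%N]mulnC expnM.
set q := (#|Q| ^ g)%N; have q0 : (0 < q)%N by rewrite expn_gt0 cardG_gt0.
suff -> : ('C(N, k) * q.-1 ^ (N - k))%:R / (q ^ N)%:R = binom_pmf N (q%:R^-1) k :> R by [].
(* For [k > N] the truncated exponent [N - k] is harmless: both sides vanish with the binomial
   coefficient. *)
clearbody q; rewrite /binom_pmf; have [kN|kN] := leqP k N; last by rewrite bin_small // !(mul0n, mul0r).
have qR : q%:R != 0 :> R by rewrite pnatr_eq0 -lt0n.
have -> : 1 - q%:R^-1 = q.-1%:R / q%:R :> R.
  by rewrite -subn1 natrB // mulrBl divff // mul1r.
rewrite natrM !natrX expr_div_n exprVn.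
have -> : q%:R ^+ N = q%:R ^+ k * q%:R ^+ (N - k) :> R by rewrite -exprD subnKC.
rewrite invfM.
by rewrite !mulrA; congr (_ * _); rewrite -!mulrA; congr (_ * _); rewrite mulrC.
Qed.

(** * Limits as the number of generators grows *)

(* A non-generating tuple lies in a proper subgroup, of order at most |Q|/2. *)
Lemma card_gen_tuples_ge (gT : finGroupType) (Q : {group gT}) (g : nat) :
  (2 ^ g * #|Q| ^ g <= 2 ^ g * #|gen_tuples Q g| + #|{group gT}| * #|Q| ^ g)%N.
Proof.
have cX (H : {group gT}) : #|setXn (fun _ : 'I_g => H : {set gT})| = (#|H| ^ g)%N.
  by rewrite cardsXn prod_nat_const card_ord.
pose U := (\bigcup_(H : {group gT} | H \proper Q) setXn (fun _ : 'I_g => H : {set gT}))%SET.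
have sub : setXn (fun _ : 'I_g => Q : {set gT}) \subset gen_tuples Q g :|: U.
  apply/fintype.subsetP => x /setXnP xQ; rewrite finset.in_setU orbC.
  have [//|nx] := boolP (x \in U).
  have gQ : <<[set x i | i : 'I_g]>>%g \subset Q.
    by rewrite gen_subG; apply/fintype.subsetP => _ /imsetP[i _ ->].
  rewrite inE; apply/andP; split; first by apply/forallP.
  apply: contraNT nx => ne; apply/finset.bigcupP.
  exists [group of <<[set x i | i : 'I_g]>>%g]; first by rewrite /= finset.properEneq ne.
  by apply/setXnP=> i; rewrite mem_gen // imset_f.
have := subset_leq_card sub; rewrite cX => /leq_trans le.
rewrite (leq_trans (leq_mul (leqnn _) (le _ (leq_card_setU _ _)))) // mulnDr leq_add2l.
have cU : (#|U| <= \sum_(H : {group gT} | H \proper Q) #|H| ^ g)%N.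
  rewrite /U; elim/big_rec2: _ => [|H n B _ IH]; first by rewrite cards0.
  by rewrite (leq_trans (leq_card_setU _ _)) // cX leq_add2l.
rewrite (leq_trans (leq_mul (leqnn _) cU)) // big_distrr /= -sum_nat_const.
(* The number of proper subgroups of [Q] is bounded crudely by the number of all subgroups of [gT],
   a constant in [g]. *)
rewrite [leqRHS](bigID (fun H : {group gT} => H \proper Q)) /=.
apply: leq_trans (leq_addr _ _); apply: leq_sum => H HQ.
have le2 : (2 * #|H| <= #|Q|)%N.
  rewrite -(Lagrange (proper_sub HQ)) mulnC leq_mul2l.
  by rewrite indexg_gt1 proper_subn ?orbT.
by rewrite -expnMn; case: (posnP g) => [->|g0]; rewrite ?expn0 ?leq_exp2r.
Qed.

(** By freeness [mu] is the proportion of generating tuples divided by [#|Aut Q|], and that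
    proportion lies between [1 - C / 2 ^+ g] and [1]. *)
Lemma cvg_mu_const (R : realType) (gT : finGroupType) (Q : {group gT}) :
  (fun g : nat => mu_const R Q g) @ \oo --> ((#|Aut Q|%:R)^-1 : R).
Proof.
set a : R := #|Aut Q|%:R; pose C : R := #|{group gT}|%:R.
have a0 : 0 < a by rewrite ltr0n cardG_gt0.
have muE g : mu_const R Q g = #|gen_tuples Q g|%:R / (#|Q| ^ g)%:R / a.
  rewrite card_gen_tuples /mu_const natrM -/a; field.
  by rewrite !pnatr_eq0 -!lt0n expn_gt0 !cardG_gt0.
apply: (@squeeze_cvgr _ _ _ _ (fun g => (1 - C * 2^-1 ^+ g) / a) (fun=> a^-1)).
- near=> g; rewrite muE.
  have q0 : 0 < (#|Q| ^ g)%:R :> R by rewrite ltr0n expn_gt0 cardG_gt0.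
  apply/andP; split.
    rewrite ler_pM2r ?invr_gt0 // ler_pdivlMr // exprVn.
    have t0 : 0 < 2 ^+ g :> R by rewrite exprn_gt0.
    have := card_gen_tuples_ge Q g; rewrite -(ler_nat R) natrD !natrM -/C.
    rewrite [(2 ^ g)%:R]natrX => h; rewrite -(ler_pM2l t0).
    have -> x : 2 ^+ g * ((1 - C / 2 ^+ g) * x) = 2 ^+ g * x - C * x.
      by field; rewrite gt_eqF.
    by rewrite lerBlDr.
  rewrite -[leRHS]mul1r ler_pM2r ?invr_gt0 // ler_pdivrMr // mul1r ler_nat.
  have <- : #|setXn (fun _ : 'I_g => Q : {set gT})| = (#|Q| ^ g)%N.
    by rewrite cardsXn prod_nat_const card_ord.
  apply/subset_leq_card/fintype.subsetP => x xQ; apply/setXnP => i.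
  exact: gen_tuple_in.
- rewrite -[X in _ --> X]mul1r; apply: cvgM; last exact: cvg_cst.
  rewrite -[X in _ --> X]subr0; apply: cvgB; first exact: cvg_cst.
  rewrite -(mulr0 C); apply: cvgM; first exact: cvg_cst.
  by apply: cvg_expr; rewrite ger0_norm ?invr_ge0 // invf_lt1 // ltr1n.
- exact: cvg_cst.
Unshelve. all: by end_near. Qed.

(** The mass at [k] splits into a product of [k] factors [(N - i) * p] over [k!], tending to
    [l ^+ k / k!], and [(1 - p) ^+ (N - k)], tending to [expR (- l)]. *)
Lemma cvg_binom_poisson (R : realType) (N : nat -> nat) (p : nat -> R) (l : R) k :
  0 < l -> (forall n, 0 <= p n) -> p @ \oo --> 0 ->
  (fun n => (N n)%:R * p n) @ \oo --> l ->
  (fun n => binom_pmf (N n) (p n) k) @ \oo --> poisson_pmf l k.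
Proof.
move=> l0 p0 cp cNp.
have cNi i : (fun n => (N n - i)%:R * p n) @ \oo --> l.
  apply: (@squeeze_cvgr _ _ _ _ (fun n => (N n)%:R * p n - i%:R * p n)
    (fun n => (N n)%:R * p n)) => //.
    near=> n; rewrite -mulrBl !ler_wpM2r //.
      by rewrite ler_nat leq_subr.
    by rewrite lerBlDr -natrD ler_nat addnC -leq_subLR.
  rewrite -[X in _ --> X]subr0; apply: cvgB => //.
  by rewrite -(mulr0 (i%:R : R)); apply: cvgM => //; apply: cvg_cst.
rewrite /poisson_pmf l0.
rewrite (_ : (fun n => _) = (fun n => (\prod_(i < k) ((N n - i)%:R * p n)) / k`!%:R
    * (1 - p n) ^+ (N n - k))); last first.
  apply/funext => n; rewrite /binom_pmf; congr (_ * _).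
  rewrite big_split /= prodr_const card_ord -natr_prod -ffact_prod -bin_ffact natrM.
  by rewrite mulrAC mulfK // pnatr_eq0 -lt0n fact_gt0.
apply: cvgM.
  apply: cvgM; last exact: cvg_cst.
  rewrite -[X in _ ^+ X](card_ord k) -prodr_const.
  by apply: cvg_big => [|i _]; [exact: mul_continuous|apply: cNi].
have c1p : (fun n => 1 - p n) @ \oo --> (1 : R).
  by rewrite -[X in _ --> X]subr0; apply: cvgB => //; apply: cvg_cst.
have cexp (u : nat -> R) x : u @ \oo --> x -> (fun n => expR (- u n)) @ \oo --> expR (- x).
  move=> ux; apply: (cvg_comp _ expR); last exact: continuous_expR.
  exact: cvgN.
(* Both bounds come from [1 + x <= expR x]: at [x = - p] it bounds [1 - p] above, and at
   [x = p / (1 - p)], after inversion, it gives [expR (- (p / (1 - p))) <= 1 - p]. *)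
apply: (@squeeze_cvgr _ _ _ _
    (fun n => expR (- ((N n - k)%:R * p n / (1 - p n))))
    (fun n => expR (- ((N n - k)%:R * p n)))).
- near=> n.
  have p1 : 0 < 1 - p n.
    by near: n; apply: (cvgr_gt 1 c1p).
  rewrite -mulrA -(mulrN _ (p n)) -(mulrN _ (p n / _)) !expRM_natl.
  apply/andP; split; apply: lerXn2r; rewrite ?nnegrE ?expR_ge0 ?(ltW p1) //; last first.
    exact: expR_ge1Dx.
  rewrite expRN -[leRHS]invrK lef_pV2 ?posrE ?expR_gt0 ?invr_gt0 //.
  apply: le_trans (expR_ge1Dx _); rewrite le_eqVlt; apply/orP; left; apply/eqP.
  by field; rewrite gt_eqF.
- apply: cexp; rewrite -[X in _ --> X]divr1; apply: cvgM; first exact: cNi.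
  by apply: cvgV => //; apply: oner_neq0.
- exact/cexp/cNi.
Unshelve. all: by end_near. Qed.

(** * Passage from the laws of the count to the three claims *)

Lemma pres_probC (R : realType) g n (P : pred (presentation g n)) :
  pres_prob R (fun r => ~~ P r) = 1 - pres_prob R P.
Proof.
have T0 : #|{: presentation g n}|%:R != 0 :> R.
  by rewrite pnatr_eq0 -lt0n; apply/card_gt0P; exists [ffun=> [ffun=> None]].
rewrite /pres_prob (_ : [set r | ~~ P r] = ~: [set r | P r]); last first.
  by apply/setP=> r; rewrite !inE.
rewrite -[X in X - _](divff T0) -mulrBl; congr (_ / _).
by rewrite -(cardsC [set r | P r]) natrD addrC addKr.
Qed.

Lemma num_epi_mod_aut_eq0 (gT : finGroupType) (Q : {group gT}) g n (r : presentation g n) :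
  (num_epi_mod_aut Q r == 0%N) = (epi_tuples Q r == finset.set0).
Proof. by rewrite cards_eq0 imset_eq0. Qed.

Unset Implicit Arguments.

Theorem theorem3p5 (R : realType) (gT : finGroupType) (Q : {group gT}) :
  simple Q -> ~~ abelian Q ->
  (* (1) for every g >= 1, the limiting probability (n -> oo) that the presented
     group has an epimorphism onto Q is 1 - (1 - |Q|^-g)^(|Q|^g mu),
     where |Q|^g mu = N is the number of epis F_g ->> Q mod Aut(Q) *)
  (forall g : nat, (0 < g)%N ->
     (fun n : nat =>
        pres_prob R (fun r : presentation g n => epi_tuples Q r != finset.set0))
       @ \oo -->
     (1 - (1 - ((#|Q| ^ g)%N%:R)^-1) ^+ num_epi_free_mod_aut Q g : R)) /\
  (* (2) mu -> 1/|Aut(Q)| as g -> oo *)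
  ((fun g : nat => mu_const R Q g) @ \oo --> ((#|Aut Q|%:R)^-1 : R)) /\
  (* (3) for each g >= 1 the limiting distribution (n -> oo) of the number of
     epis onto Q mod Aut(Q) exists, and these converge pointwise (g -> oo)
     to the Poisson distribution with mean 1/|Aut(Q)| *)
  (exists pi : nat -> nat -> R,
     (forall g : nat, (0 < g)%N -> forall k : nat,
        (fun n : nat =>
           pres_prob R (fun r : presentation g n => num_epi_mod_aut Q r == k))
          @ \oo --> pi g k) /\
     (forall k : nat,
        (fun g : nat => pi g k) @ \oo --> poisson_pmf ((#|Aut Q|%:R)^-1 : R) k)).

Proof.
move=> simQ nabQ; split; [|split; first exact: cvg_mu_const].
  move=> g _; set p := _^-1; set N := num_epi_free_mod_aut Q g.
  (* The complementary event is that the count is zero, so its limit is the binomial mass at [0]. *)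
  have -> : (1 - p) ^+ N = binom_pmf N p 0 by rewrite /binom_pmf bin0 expr0 !mul1r subn0.
  rewrite (_ : (fun n => _) = (fun n => 1 - pres_prob R
    (fun r : presentation g n => num_epi_mod_aut Q r == 0%N))); last first.
    apply/funext => n; rewrite -pres_probC; congr (_%:R / _).
    by apply: eq_card => r; rewrite !inE num_epi_mod_aut_eq0.
  by apply: cvgB; [exact: cvg_cst|exact: cvg_num_epi].
exists (fun g => binom_pmf (num_epi_free_mod_aut Q g) (#|Q| ^ g)%N%:R^-1).
split=> [g _ k|k]; first exact: cvg_num_epi.
apply: cvg_binom_poisson.
- by rewrite invr_gt0 ltr0n cardG_gt0.
- by move=> g; rewrite invr_ge0.
- have Q1 : (1 < #|Q|)%N by rewrite cardG_gt1; case/simpleP: simQ.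
  under eq_fun do rewrite natrX -exprVn.
  apply: cvg_expr; rewrite ger0_norm ?invr_ge0 // invf_lt1 ?ltr1n //.
  by rewrite ltr0n cardG_gt0.
(* The binomial mean [N * p] is [mu_const] by definition. *)
- exact: cvg_mu_const.
Qed.
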